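(* Suppose $\mathfrak{F}=fD$ is a prime ideal of $D$. Then every basic $\mathfrak{F}$-primary ideal of $O$ contains $\mathfrak{F}^2$, and lies in the following set of pairwise distinct ideals: $$\mathcal J = \{ (f, f^{2}\omega),\ (f^{2}, f(a + \omega)) : 0 \le a < f \}.$$
   Context: Let $d$ be a square-free integer ($d\neq 1$), $K=\mathbb{Q}(\sqrt d)$ and $D=\mathbb{Z}[\omega]$ its ring of integers, where $\omega=\sqrt d$ if $d\equiv 2,3 \pmod 4$ and $\omega=(1+\sqrt d)/2$ if $d\equiv 1\pmod 4$. Let $f$ be a prime number and $O=\mathbb{Z}[f\omega]$, the unique order of $K$ with $[D:O]=f$. The conductor of $O$ is $\mathfrak{F}=\{x\in O: xD\subseteq O\}=fD$; it is a prime ideal of $O$. An ideal of $O$ is $\mathfrak{F}$-primary if it is primary with radical $\mathfrak{F}$; an $\mathfrak{F}$-primary ideal is basic if it is not contained in $\mathfrak{F}^2$. For $\alpha,\beta\in O$, $(\alpha,\beta)=\alpha O+\beta O$. The integer $a$ ranges over $0,1,\dots,f-1$.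
   Formalization: Membership in J is claimed only for basic F-primary ideals other than F itself: F is basic and F-primary but has index f in O, while every member of J has index f², so the claim as written fails for F (e.g. d = −1, f = 3). *)

(* Defs.v *)
From HB Require Import structures.
From mathcomp Require Import all_boot all_order all_algebra all_field.
From mathcomp Require Import ring_quotient ring.
From mathcomp Require Import boolp classical_sets.
Set Implicit Arguments.
Unset Strict Implicit.
Unset Printing Implicit Defensive.
Import Order.TTheory GRing.Theory Num.Theory.
Local Open Scope classical_set_scope.
Local Open Scope ring_scope.

Section Ideals.
Variable R : comNzRingType.
Implicit Types I J P Q : set R.

(* MathComp's [idealr_closed] includes properness: 1 \notin I. *)
Definition prime_ideal P : Prop :=
  idealr_closed (mem P) /\ prime_idealr_closed (mem P).

Definition primary_ideal Q : Prop :=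
  idealr_closed (mem Q) /\
  forall x y, Q (x * y) -> Q x \/ exists n : nat, Q (y ^+ n).

Definition radical I : set R := [set x | exists n : nat, I (x ^+ n)].

Definition ideal_mul I J : set R :=
  [set x | exists (n : nat) (u v : 'I_n -> R),
     (forall i, I (u i) /\ J (v i)) /\ x = \sum_i u i * v i].

Definition ideal1 (a : R) : set R := [set a * x | x in setT].

Definition ideal2 (a b : R) : set R := [set x | exists y z, x = a * y + b * z].

Definition primary_to P Q : Prop := primary_ideal Q /\ radical Q = P.

Definition basic_primary P Q : Prop :=
  primary_to P Q /\ ~ (Q `<=` ideal_mul P P).

End Ideals.

Section Adjoin.
Variable z : algC.

Definition Zadj_pred : {pred algC} :=
  [pred x | `[< exists p : {poly int}, x = (map_poly intr p).[z] >]].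

Lemma Zadj_subring_closed : subring_closed Zadj_pred.
Proof.
split.
- by apply/asboolP; exists 1; rewrite rmorph1 hornerC.
- move=> _ _ /asboolP[p ->] /asboolP[q ->]; apply/asboolP; exists (p - q).
  by rewrite rmorphB hornerD hornerN.
- move=> _ _ /asboolP[p ->] /asboolP[q ->]; apply/asboolP; exists (p * q).
  by rewrite rmorphM hornerM.
Qed.

HB.instance Definition _ :=
  GRing.isSubringClosed.Build algC Zadj_pred Zadj_subring_closed.

(* The ring Z[z]. *)
Definition Zadj : Type := {x : algC | x \in Zadj_pred}.

HB.instance Definition _ := SubType.on Zadj.
HB.instance Definition _ := Choice.on Zadj.
HB.instance Definition _ := [SubChoice_isSubComNzRing of Zadj by <:].

Lemma Zadj_gen_subproof : z \in Zadj_pred.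
Proof. by apply/asboolP; exists 'X; rewrite map_polyX hornerX. Qed.

Definition Zadj_gen : Zadj := exist _ z Zadj_gen_subproof.

End Adjoin.

Definition squarefree (d : int) : Prop :=
  forall m : int, (m ^+ 2 %| d)%Z -> m \is a GRing.unit.

Definition omega (d : int) : algC :=
  if (d %% 4)%Z == 1 then (1 + sqrtC d%:~R) / 2 else sqrtC d%:~R.

Definition maxorder (d : int) := Zadj (omega d).

Definition quadorder (d : int) (f : nat) := Zadj (f%:R * omega d).

Definition conductor (d : int) (f : nat) : set (quadorder d f) :=
  [set x | forall y : maxorder d, val x * val y \in Zadj_pred (f%:R * omega d)].

(* The element f * omega of O; so [f%:R * fomega] is f^2 omega and
   [f%:R * a%:R + fomega] is f (a + omega). *)
Definition fomega (d : int) (f : nat) : quadorder d f :=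
  Zadj_gen (f%:R * omega d).

(* The conductor itself, of index f in O, is never a member: when f D is prime,
   all members have index f ^ 2. *)
Definition Jfamily (d : int) (f : nat) (i : option 'I_f) : set (quadorder d f) :=
  match i with
  | None => ideal2 f%:R (f%:R * fomega d f)
  | Some a => ideal2 (f%:R ^+ 2) (f%:R * a%:R + fomega d f)
  end.

Lemma omega_sqr d : exists t n : int, omega d ^+ 2 = t%:~R * omega d + n%:~R.
Proof.
rewrite /omega; case: eqP => [d1|_]; last first.
  by exists 0, d; rewrite sqrtCK mul0r add0r.
exists 1, (d %/ 4)%Z.
have e : (d%:~R : algC) = (d %/ 4)%Z%:~R * 4 + 1.
  by rewrite {1}(divz_eq d 4) d1 rmorphD rmorphM.
have s : sqrtC d%:~R ^+ 2 = (d %/ 4)%Z%:~R * 4 + 1 :> algC by rewrite sqrtCK.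
have two : (2 : algC) != 0 by rewrite pnatr_eq0.
move: s; move: (sqrtC _) ((d %/ 4)%Z%:~R) => u v s.
apply: (@mulfI _ 4); first by rewrite pnatr_eq0.
transitivity (1 + 2 * u + u ^+ 2); first by field.
by rewrite s; field.
Qed.


Lemma sqrt_irrat d : squarefree d -> d <> 1 -> sqrtC (d%:~R : algC) \notin Crat.
Proof.
move=> sq d1; apply/negP => r.
have /intrP[m em] : sqrtC (d%:~R : algC) \is a Num.int.
  apply: Cint_rat_Aint => //.
  apply: (@root_monic_Aint ('X^2 - (d%:~R)%:P)).
  - by rewrite rootE !hornerE sqrtCK subrr.
  - by apply: monicXnsubC.
  - apply/polyOverP => i; rewrite coefB coefXn coefC; apply/intrP.
    exists ((i == 2)%:Z - (if i == 0 then d else 0)).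
    by rewrite rmorphB; case: (i == 2); case: (i == 0).
have dm : d = m ^+ 2.
  by apply: (@intr_inj algC); rewrite rmorphXn /= -em sqrtCK.
have := sq m; rewrite dm dvdzz => /(_ isT).
move=> u; case: d1; rewrite dm; move: u; rewrite unfold_in /=.
by case/orP => /eqP->.
Qed.

Lemma omega_irrat d : squarefree d -> d <> 1 -> omega d \notin Crat.
Proof.
move=> sq d1; have := sqrt_irrat sq d1; rewrite /omega; case: ifP => // _.
apply: contra => h; have -> : sqrtC d%:~R = 2 * ((1 + sqrtC d%:~R) / 2) - 1 :> algC.
  by field.
have q2 : (2:algC) \in Crat by apply: rpred_nat.
by apply: rpredB; [apply: rpredM | apply: rpred1].
Qed.

Lemma omega_free d (a b a' b' : int) : squarefree d -> d <> 1 ->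
  a%:~R + b%:~R * omega d = a'%:~R + b'%:~R * omega d -> a = a' /\ b = b'.
Proof.
move=> sq d1 e; have := omega_irrat sq d1.
case: (eqVneq b b') => [eb|nb] h.
  split=> //; apply: (@intr_inj algC); move: e; rewrite eb; exact: addIr.
case/negP: h; have -> : omega d = (a' - a)%:~R / (b - b')%:~R.
  have n : (b - b')%:~R != 0 :> algC by rewrite intr_eq0 subr_eq0.
  apply: (mulIf n); rewrite mulfVK // !rmorphB mulrBr ![omega d * _]mulrC.
  by apply/eqP; rewrite subr_eq -addrA [- _ + _]addrC addrA -e addrAC subrr add0r.
by rewrite rpred_div // rpred_int.
Qed.

Lemma ZadjP d f x : reflect (exists a b : int, x = a%:~R + b%:~R * (f%:R * omega d))
  (x \in Zadj_pred (f%:R * omega d)).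
Proof.
apply: (iffP idP); last first.
  move=> [a [b ->]]; apply: rpredD; [|apply: rpredM]; rewrite ?rpred_int //.
  exact: Zadj_gen_subproof.
have [t [n e]] := omega_sqr d.
move=> /asboolP[p ->]; elim/poly_ind: p => [|p c [a [b IH]]].
  by exists 0, 0; rewrite rmorph0 horner0 mul0r addr0.
exists (b * (f%:Z * f%:Z * n) + c), (a + b * (f%:Z * t)).
rewrite rmorphD rmorphM /= map_polyX map_polyC /= hornerD hornerMX hornerC IH.
transitivity (a%:~R * (f%:R * omega d) + b%:~R * (f%:R ^+ 2 * (omega d ^+ 2)) + c%:~R).
  by ring.
rewrite e !rmorphD !rmorphM /= -!pmulrn; ring.
Qed.

Lemma ZomegaP d x : reflect (exists a b : int, x = a%:~R + b%:~R * omega d)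
  (x \in Zadj_pred (omega d)).
Proof. by have := ZadjP d 1 x; rewrite mul1r. Qed.

(* The conductor of O is f D. *)
Lemma conductorE d f : squarefree d -> d <> 1 -> 
  @conductor d f = [set x | exists y : maxorder d, val x = f%:R * val y].
Proof.
move=> sq d1; apply/seteqP; split=> x /=.
- move=> /(_ (Zadj_gen _))/= /ZadjP[a [b e]].
  have /ZadjP[a' [b' e']] := valP x.
  have [t [n w2]] := omega_sqr d.
  have : (f%:Z * b' * n)%:~R + (a' + f%:Z * b' * t)%:~R * omega d =
     a%:~R + (b * f%:Z)%:~R * omega d.
    transitivity (val x * omega d); last by rewrite e rmorphM /= -pmulrn; ring.
    rewrite e' mulrDl.
    rewrite (_ : b'%:~R * (f%:R * omega d) * omega d =
                 b'%:~R * f%:R * omega d ^+ 2); last by ring.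
    rewrite w2 !rmorphD !rmorphM /= -!pmulrn; ring.
  case/(omega_free sq d1) => _ ea.
  have h : (b - b' * t)%:~R + b'%:~R * omega d \in Zadj_pred (omega d).
    by apply/ZomegaP; exists (b - b' * t), b'.
  exists (exist (fun x => x \in Zadj_pred (omega d)) _ h); rewrite e' /=.
  have -> : a' = f%:Z * (b - b' * t).
    by rewrite -[a'](addrK (f%:Z * b' * t)) ea; ring.
  rewrite !rmorphM !rmorphB /= -!pmulrn rmorphM /=; ring.
- move=> [y e] z; rewrite [val x]e -mulrA.
  have /ZomegaP[a [b ->]] : val y * val z \in Zadj_pred (omega d).
    by rewrite rpredM ?(valP y) ?(valP z).
  apply/ZadjP; exists (f%:Z * a), b; rewrite rmorphM /= -pmulrn; ring.
Qed.

(* Main.v *)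
Require Import Defs.
From mathcomp Require Import all_boot all_order all_algebra all_field.
From mathcomp Require Import intdiv ring ring_quotient.
From mathcomp Require Import boolp classical_sets.
Set Implicit Arguments.
Unset Strict Implicit.
Unset Printing Implicit Defensive.
Import GRing.Theory Num.Theory.
Local Open Scope classical_set_scope.
Local Open Scope ring_scope.

(** Multiplication by [f] identifies [D] with the conductor [F = f D], and
[D / f D] with [F / F^2]. So [F / F^2] is the plane over the field of [f]
elements with the classes of [f] and [f omega] as a basis, and both halves of
the theorem are read off from it.

Why a basic [F]-primary ideal [Q] contains [F^2]: take [q = f y] in [Q] outside
[F^2], so [y] is not in [f D]. Multiplying [q] by [f y' u], where [y'] is the
conjugate of [y] and [u] is any element of [D], gives [f^2 u N] with
[N = y y'] the integer norm of [y]. As [f D] is prime, stable under conjugation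
and does not contain [y], the prime [f] does not divide [N]
([prime_norm_anisotropic]); hence [N] is outside [F], the radical of [Q], and
primarity removes it: [f^2 u] is in [Q] ([basic_primary_sqr]).

Why [Q] is then in the list: an ideal strictly between [F^2] and [F] is a line
of the plane [F / F^2], because two independent points of the plane already
generate it, and a point generates its line
([intermediate_ideal_slope]). The lines of the plane are indexed by their
slopes: the line through [f] is the slope [None], the line through
[f (a + omega)] is the slope [Some a]. Their preimages in [O] are the ideals of
the family ([slope_set_None], [slope_set_Some]), and distinct lines have
distinct preimages ([slope_set_inj]).

All of this happens inside [O], once [O] is described as a ring with a
[Z]-basis [1, w] such that [w^2 = f t w + f^2 n] and whose norm form is
anisotropic modulo [f]; here [w] is [f omega], and [t], [n] are the
coefficients in [omega^2 = t omega + n]. *)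

(** * Lines of the plane over a prime field *)

Section PlaneModPrime.
Variable f : nat.
Hypothesis f_prime : prime f.
Implicit Types (b c x y k : int) (s : option 'I_f).

Lemma dvdz_mul_prime x y : (f %| x * y)%Z = (f %| x)%Z || (f %| y)%Z.
Proof. by rewrite !dvdzE abszM Euclid_dvdM. Qed.

Lemma inv_mod_prime c : ~~ (f %| c)%Z -> exists k m : int, k * c = 1 + m * f.
Proof.
move=> nc; have : coprimez c f.
  by rewrite coprimez_sym coprimezE prime_coprime // -dvdzE.
by case/coprimezP=> -[k m] /= e; exists k, (- m); rewrite -e; ring.
Qed.

(** The linear equation, in integer coordinates, of the line of slope [s]: the
line spanned by [(1, 0)] for [None] and by [(a, 1)] for [Some a]. *)
Definition slope_form s b c : int := if s is Some a then b - c * (a : nat) else c.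

(** Every point is on a line: if [c] is invertible modulo [f], the slope is
[b / c], otherwise the point is on the line of [(1, 0)]. *)
Lemma slope_form_exists b c : exists s, (f %| slope_form s b c)%Z.
Proof.
have [fc|nc] := boolP (f %| c)%Z; first by exists None.
have [k [m e]] := inv_mod_prime nc.
have f0 : (f : int) != 0 by rewrite eqz_nat -lt0n prime_gt0.
have r0 := modz_ge0 (k * b) f0.
have rf : (`|(k * b %% f)%Z| < f)%N.
  by rewrite -ltz_nat gez0_abs // ltz_pmod // ltz_nat prime_gt0.
exists (Some (Ordinal rf)); rewrite /= gez0_abs //.
have -> : b - c * (k * b %% f)%Z = (c * (k * b %/ f)%Z - m * b) * f.
  have := divz_eq (k * b) f; set r := (_ %% _)%Z; set q := (_ %/ _)%Z => h.
  have -> : r = k * b - q * f by rewrite h; ring.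
  transitivity (b - (k * c) * b + c * q * f); first by ring.
  by rewrite e; ring.
exact: dvdz_mull.
Qed.

(** A nonzero point determines its line, so membership in the line is
proportionality to that point, that is, vanishing of the determinant. *)
Lemma slope_form_det s b c x y : ~~ ((f %| b)%Z && (f %| c)%Z) ->
  (f %| slope_form s b c)%Z -> (f %| slope_form s x y)%Z = (f %| b * y - x * c)%Z.
Proof.
case: s => [a|] /= nz l.
  have nc : (f %| c)%Z = false.
    apply: contraNF nz => h; rewrite h andbT -(subrK (c * (a : nat)) b).
    by rewrite rpredD // dvdz_mulr.
  have -> : b * y - x * c = y * (b - c * (a : nat)) - c * (x - y * (a : nat)).
    by ring.
  by rewrite [RHS]rpredBl ?(dvdz_mull _ l) // dvdz_mul_prime nc.
rewrite l andbT in nz.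
by rewrite [RHS]rpredBr ?(dvdz_mull _ l) // dvdz_mul_prime (negbTE nz).
Qed.

Lemma slope_form_inj s s' :
  (forall b c, (f %| slope_form s b c)%Z = (f %| slope_form s' b c)%Z) -> s = s'.
Proof.
have f1 : (f %| 1)%Z = false by rewrite dvdzE dvdn1; case: f f_prime => [|[]].
case: s s' => [a|] [a'|] // h.
- have := h (a : nat) 1; rewrite /= !mul1r subrr dvdz0 => /esym.
  rewrite -eqz_mod_dvd !modz_nat eqz_nat.
  by rewrite !modn_small // => /eqP e; congr Some; apply: val_inj.
- by have := h 1 0; rewrite /= mul0r subr0 f1 dvdz0.
- by have := h 1 0; rewrite /= mul0r subr0 f1 dvdz0.
Qed.

End PlaneModPrime.

(** * Closure properties of ideals given as sets *)

Section Ideals.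
Variables (R : comNzRingType) (Q : set R).
Hypothesis idQ : idealr_closed (mem Q).

Lemma ideal_lin a u v : Q u -> Q v -> Q (a * u + v).
Proof. by case: idQ => _ _ h Qu Qv; apply/asboolP/h; apply/asboolP. Qed.

Lemma idealD u v : Q u -> Q v -> Q (u + v).
Proof. by rewrite -{2}[u]mul1r; apply: ideal_lin. Qed.

Lemma idealMl a u : Q u -> Q (a * u).
Proof.
move=> Qu; rewrite -[a * u]addr0; apply: ideal_lin => //.
by case: idQ => Q0 _ _; apply/asboolP.
Qed.

End Ideals.

(** * Ideals between the conductor and its square *)

Section QuadraticOrder.
Variables (R : comNzRingType) (w : R) (f : nat) (t n : int).
Hypothesis f_prime : prime f.
Hypothesis w_sqr : w ^+ 2 = t%:~R * f%:R * w + n%:~R * f%:R ^+ 2.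
Hypothesis w_span : forall x : R, exists b c : int, x = b%:~R + c%:~R * w.
Hypothesis w_free : forall b c b' c' : int,
  b%:~R + c%:~R * w = b'%:~R + c'%:~R * w -> b = b' /\ c = c'.
Implicit Types (b c x y k : int) (s : option 'I_f) (Q : set R).

(** With [w = f omega] this is [f (b + c omega)]: the coordinates of a point of
the conductor are those of its quotient by [f] in the maximal order. *)
Definition cpt b c : R := b%:~R * f%:R + c%:~R * w.

(** The conductor [f D]. *)
Definition cspan : set R := [set z | exists b c, z = cpt b c].

(** The norm of [b + c omega] when [omega^2 = t omega + n]. *)
Definition norm b c : int := b ^+ 2 + t * b * c - n * c ^+ 2.

Lemma cpt_mul b c x y :
  cpt b c * cpt x y = f%:R * cpt (b * x + n * c * y) (b * y + c * x + t * c * y).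
Proof.
rewrite /cpt !rmorphD !rmorphM /=.
transitivity (b%:~R * x%:~R * f%:R ^+ 2 + (b%:~R * y%:~R + c%:~R * x%:~R) * f%:R * w
  + c%:~R * y%:~R * w ^+ 2 :> R); first by ring.
by rewrite w_sqr; ring.
Qed.

(** The second factor is [f v' u] for [v = b + c omega], [u = x + y omega] and
[v' = b + t c - c omega] the conjugate of [v]: this is [(f v)(f v' u) = f^2 u N],
written without leaving the order. *)
Lemma cpt_conj_mul b c x y :
  cpt b c * cpt ((b + t * c) * x - n * c * y) (b * y - c * x) =
  f%:R * cpt x y * (norm b c)%:~R.
Proof.
by rewrite cpt_mul -[RHS]mulrA; congr (_ * _); rewrite /cpt /norm; ring.
Qed.

Lemma cpt_inj b c x y : cpt b c = cpt x y -> b = x /\ c = y.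
Proof.
have f0 : (f : int) != 0 by rewrite eqz_nat -lt0n prime_gt0.
rewrite /cpt !pmulrn -!rmorphM => /w_free[e ->]; split=> //.
exact: mulIf e.
Qed.

Lemma cspan_int k : cspan k%:~R -> (f %| k)%Z.
Proof.
case=> b [c]; rewrite /cpt pmulrn -rmorphM /= => e.
have [-> _] : k = b * f /\ 0 = c by apply: w_free; rewrite mul0r addr0.
exact: dvdz_mull.
Qed.

Lemma cpt_mulf b c : f%:R * cpt b c = cpt (b * f) (c * f).
Proof. by rewrite /cpt !rmorphM /= -!pmulrn; ring. Qed.

Lemma cpt_cspan2 x y : ideal_mul cspan cspan (f%:R * cpt x y).
Proof.
exists 1%N, (fun=> cpt 1 0), (fun=> cpt x y); rewrite big_ord1; split.
  by move=> _; split; [exists 1, 0 | exists x, y].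
by rewrite {2}/cpt mul1r mul0r addr0.
Qed.

Lemma cspan2_cpt z : ideal_mul cspan cspan z -> exists x y, z = f%:R * cpt x y.
Proof.
case=> m [u [v [h ->]]]; elim/big_ind: _.
- by exists 0, 0; rewrite /cpt !mul0r addr0 mulr0.
- move=> _ _ [x [y ->]] [x' [y' ->]]; exists (x + x'), (y + y').
  by rewrite /cpt !rmorphD /=; ring.
- move=> i _; have [[b [c ->]] [x [y ->]]] := h i; rewrite cpt_mul.
  by do 2 eexists.
Qed.

Lemma cpt_outside_cspan2 Q : Q `<=` cspan -> ~ (Q `<=` ideal_mul cspan cspan) ->
  exists b c, Q (cpt b c) /\ ~~ ((f %| b)%Z && (f %| c)%Z).
Proof.
move=> QF nQ; apply: contrapT => h; apply: nQ => q Qq.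
have [b [c e]] := QF q Qq; rewrite {q}e in Qq *.
have [/andP[/dvdzP[k ->] /dvdzP[m ->]]|nz] := boolP ((f %| b)%Z && (f %| c)%Z).
  by rewrite -cpt_mulf; apply: cpt_cspan2.
by case: h; exists b, c.
Qed.

Definition slope_set s : set R :=
  [set z | exists b c, z = cpt b c /\ (f %| slope_form s b c)%Z].

Lemma slope_set_cpt s b c : slope_set s (cpt b c) <-> (f %| slope_form s b c)%Z.
Proof.
split; last by exists b, c.
by case=> x [y [/cpt_inj[-> ->]]].
Qed.

Lemma slope_set_inj : injective slope_set.
Proof.
move=> s s' e; apply: (slope_form_inj f_prime) => b c.
by apply/idP/idP => /slope_set_cpt h; apply/slope_set_cpt; [rewrite -e | rewrite e].
Qed.

(** In a product by [f w], both terms of [w^2] bring a factor [f], so the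
[w]-coordinate stays divisible by [f]; that is the equation of the line. *)
Lemma slope_set_None : slope_set None = ideal2 f%:R (f%:R * w).
Proof.
apply/seteqP; split=> [z [b [c [-> /= /dvdzP[k ->]]]]|z [y [u ->]]].
  exists b%:~R, k%:~R; rewrite /cpt rmorphM /= -pmulrn; ring.
have [b [c ->]] := w_span y; have [b' [c' ->]] := w_span u.
(* coordinates of [f (b + c w) + f w (b' + c' w)], by the equation of [w] *)
exists (b + n * c' * f ^+ 2), ((c + b' + c' * t * f) * f).
split; last exact: dvdz_mull.
rewrite /cpt !(rmorphD, rmorphM, rmorphXn) /= -!pmulrn.
ring: w_sqr.
Qed.

(** The ideal contains [F^2], as [f^2 omega] is [f] times the second generator
minus [a] times the first. Modulo [F^2] it is the group generated by
[f (a + omega)], because every element of [O] is an integer modulo [F]. *)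
Lemma slope_set_Some (a : 'I_f) :
  slope_set (Some a) = ideal2 (f%:R ^+ 2) (f%:R * a%:R + w).
Proof.
apply/seteqP; split=> [z [b [c [-> /= /dvdzP[k e]]]]|z [y [u ->]]].
  exists k%:~R, c%:~R.
  have -> : b = k * f + c * (a : nat) by rewrite -e; ring.
  by rewrite /cpt !(rmorphD, rmorphM) /= -!pmulrn; ring.
have [b [c ->]] := w_span y; have [b' [c' ->]] := w_span u.
(* coordinates of [f^2 (b + c w) + (f a + w) (b' + c' w)] *)
exists (b * f + b' * (a : nat) + n * c' * f),
  (c * f ^+ 2 + c' * (a : nat) * f + b' + c' * t * f).
split.
  rewrite /cpt !(rmorphD, rmorphM, rmorphXn) /= -!pmulrn; ring: w_sqr.
set A : int := (a : nat); apply/dvdzP.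
exists (b + n * c' - c * f * A - c' * A ^+ 2 - c' * t * A); rewrite /= -/A; ring.
Qed.

Section Ideal.
Variable Q : set R.
Hypothesis idQ : idealr_closed (mem Q).

Lemma ideal_cpt b c x y k m : Q (cpt b c) -> Q (cpt x y) ->
  Q (cpt (k * b + m * x) (k * c + m * y)).
Proof.
move=> h h'; have := idealD idQ (idealMl idQ k%:~R h) (idealMl idQ m%:~R h').
by congr (Q _); rewrite /cpt !(rmorphD, rmorphM) /=; ring.
Qed.

(** From here on [Q] contains the square of the conductor, so that membership of
a point in [Q] depends on its coordinates modulo [f] only. *)
Hypothesis cspan2Q : forall x y, Q (f%:R * cpt x y).

Lemma ideal_cpt_mod b c x y :
  (f %| b - x)%Z -> (f %| c - y)%Z -> Q (cpt x y) -> Q (cpt b c).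
Proof.
move=> /dvdzP[k e] /dvdzP[m e'] h.
have -> : cpt b c = f%:R * cpt k m + cpt x y.
  rewrite cpt_mulf -e -e' /cpt !rmorphB /=; ring.
exact: idealD.
Qed.

(** Cramer's rule, with the determinant inverted modulo [f]. *)
Lemma ideal_cpt_indep b c x y : Q (cpt b c) -> Q (cpt x y) ->
  ~~ (f %| b * y - x * c)%Z -> cspan `<=` Q.
Proof.
move=> h h' /(inv_mod_prime f_prime)[k [m e]] _ [b' [c' ->]].
apply: ideal_cpt_mod
  (ideal_cpt (k * (b' * y - c' * x)) (k * (c' * b - b' * c)) h h').
- apply/dvdzP; exists (- m * b').
  transitivity (b' - (k * (b * y - x * c)) * b'); first by ring.
  by rewrite e; ring.
- apply/dvdzP; exists (- m * c').
  transitivity (c' - (k * (b * y - x * c)) * c'); first by ring.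
  by rewrite e; ring.
Qed.

(** A point proportional to a nonzero one is a multiple of it: the factor is
[x / b] or [y / c] modulo [f], whichever denominator is invertible. *)
Lemma ideal_cpt_dep b c x y : Q (cpt b c) -> ~~ ((f %| b)%Z && (f %| c)%Z) ->
  (f %| b * y - x * c)%Z -> Q (cpt x y).
Proof.
move=> h nz /dvdzP[l d]; case/nandP: nz => /(inv_mod_prime f_prime)[k [m e]].
- apply: ideal_cpt_mod (ideal_cpt (k * x) 0 h h).
    apply/dvdzP; exists (- m * x).
    by transitivity (x - (k * b) * x); [ring | rewrite e; ring].
  apply/dvdzP; exists (k * l - m * y).
  transitivity (y - (k * b) * y + k * (b * y - x * c)); first by ring.
  by rewrite e d; ring.
- apply: ideal_cpt_mod (ideal_cpt (k * y) 0 h h).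
    apply/dvdzP; exists (- k * l - m * x).
    transitivity (x - (k * c) * x - k * (b * y - x * c)); first by ring.
    by rewrite e d; ring.
  apply/dvdzP; exists (- m * y).
  by transitivity (y - (k * c) * y); [ring | rewrite e; ring].
Qed.

(** A point [q] of [Q] outside [F^2] fixes the slope. [Q] contains the line of
[q], and a point of [Q] off that line would be independent of [q] and make [Q]
the whole conductor. *)
Lemma intermediate_ideal_slope : Q `<=` cspan -> ~ (Q `<=` ideal_mul cspan cspan) ->
  Q <> cspan -> exists s, slope_set s = Q.
Proof.
move=> QF nQ QnF; have [b [c [Qq nz]]] := cpt_outside_cspan2 QF nQ.
have [s sbc] := slope_form_exists f_prime b c; exists s.
apply/seteqP; split=> [_ [x [y [-> h]]]|z Qz].
  by apply: (ideal_cpt_dep Qq nz); rewrite -(slope_form_det f_prime _ _ nz sbc).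
have [x [y e]] := QF z Qz; rewrite {z}e in Qz *.
apply/slope_set_cpt; rewrite (slope_form_det f_prime _ _ nz sbc).
by apply: contrapT => /negP /(ideal_cpt_indep Qq Qz) FQ; apply: QnF; apply/seteqP.
Qed.

End Ideal.

Hypothesis norm_anisotropic :
  forall b c, (f %| norm b c)%Z -> (f %| b)%Z && (f %| c)%Z.

Lemma basic_primary_sub Q : basic_primary cspan Q -> Q `<=` cspan.
Proof. by case=> [[_ <-] _] x Qx; exists 1%N; rewrite expr1. Qed.

(** The norm of the quotient by [f] of an element outside [F^2] is not in the
radical of [Q], so it can be cancelled from [f^2 u N]. *)
Lemma basic_primary_sqr Q x y : basic_primary cspan Q -> Q (f%:R * cpt x y).
Proof.
move=> bQ; have QF := basic_primary_sub bQ; case: bQ => [[[idQ prQ] radQ] nQ].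
have [b [c [Qq nz]]] := cpt_outside_cspan2 QF nQ.
have Qn : Q (f%:R * cpt x y * (norm b c)%:~R).
  by rewrite -cpt_conj_mul mulrC; apply: idealMl.
case: (prQ _ _ Qn) => // radn; case/negP: nz.
by apply/norm_anisotropic/cspan_int; rewrite -radQ.
Qed.

End QuadraticOrder.

(** * Quadratic orders *)

(** If [f] divides the norm of [b + c omega], the prime ideal [f D] contains this
element or its conjugate [b + t c - c omega]. The [omega]-coordinate of either
one gives [f | c], and the other coordinate then gives [f | b]. *)
Lemma prime_norm_anisotropic (d : int) (f : nat) (t n b c : int) :
  squarefree d -> d <> 1 -> prime_ideal (ideal1 (f%:R : maxorder d)) ->
  omega d ^+ 2 = t%:~R * omega d + n%:~R ->
  (f %| norm t n b c)%Z -> (f %| b)%Z && (f %| c)%Z.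
Proof.
move=> sq d1 [_ prP] w2 /dvdzP[k ek].
have coord (x y : int) (z : maxorder d) : val z = x%:~R + y%:~R * omega d ->
    z \in mem (ideal1 (f%:R : maxorder d)) -> (f %| x)%Z /\ (f %| y)%Z.
  move=> ez /asboolP[u _ eu]; have /ZomegaP[x' [y' eu']] := valP u.
  have : x%:~R + y%:~R * omega d = (f%:Z * x')%:~R + (f%:Z * y')%:~R * omega d.
    rewrite -ez -eu rmorphM rmorph_nat /= [sval u]eu' !rmorphM /= -!pmulrn; ring.
  by case/(omega_free sq d1) => -> ->; split; apply: dvdz_mulr.
have inD (x y : int) : x%:~R + y%:~R * omega d \in Zadj_pred (omega d).
  by apply/ZomegaP; exists x, y.
pose elt x y : maxorder d := exist (fun z => z \in Zadj_pred (omega d)) _ (inD x y).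
have : elt b c * elt (b + t * c) (- c) \in mem (ideal1 (f%:R : maxorder d)).
  apply/asboolP; exists k%:~R => //; apply: val_inj.
  rewrite !rmorphM rmorph_nat rmorph_int /=.
  have -> : f%:R * k%:~R = (norm t n b c)%:~R :> algC.
    by rewrite ek rmorphM /= -pmulrn mulrC.
  by rewrite /norm; ring: w2.
case/prP/orP=> /coord; first by case/(_ _ _ erefl)=> -> ->.
by case/(_ _ _ erefl) => h; rewrite rpredN => hc;
  rewrite hc andbT -(rpredDr _ (dvdz_mull t hc)).
Qed.

Theorem theorem4p1 (d : int) (f : nat)
    (d_sqf : squarefree d) (d_neq1 : d <> 1) (f_prime : prime f)
    (fD_prime : prime_ideal (ideal1 (f%:R : maxorder d))) :
  (forall Q : set (quadorder d f),
     basic_primary (@conductor d f) Q ->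
     ideal_mul (@conductor d f) (@conductor d f) `<=` Q /\
     (Q <> @conductor d f -> range (@Jfamily d f) Q)) /\
  injective (@Jfamily d f).
Proof.
have [t [n w2]] := omega_sqr d.
pose w := fomega d f.
have w_sqr : w ^+ 2 = t%:~R * f%:R * w + n%:~R * f%:R ^+ 2.
  apply: val_inj; rewrite !(rmorphD, rmorphM, rmorphXn, rmorph_nat, rmorph_int) /=.
  by ring: w2.
have w_span (x : quadorder d f) : exists b c : int, x = b%:~R + c%:~R * w.
  have /ZadjP[b [c e]] := valP x; exists b, c; apply: val_inj.
  by rewrite rmorphD rmorphM !rmorph_int.
have w_free (b c b' c' : int) : b%:~R + c%:~R * w = b'%:~R + c'%:~R * w ->
    b = b' /\ c = c'.
  move/(congr1 val); rewrite !rmorphD !rmorphM !rmorph_int /= => e.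
  (* [omega_free] speaks of the basis [1, omega], so [f] moves to the coefficient. *)
  have : b%:~R + (c * f)%:~R * omega d = b'%:~R + (c' * f)%:~R * omega d.
    by rewrite !rmorphM /= -!pmulrn -!mulrA.
  case/(omega_free d_sqf d_neq1) => -> /mulIf ->; rewrite //.
  by rewrite eqz_nat -lt0n prime_gt0.
have val_cpt (b c : int) :
    val (cpt w f b c) = f%:R * (b%:~R + c%:~R * omega d) :> algC.
  by rewrite !(rmorphD, rmorphM, rmorph_int, rmorph_nat) /=; ring.
have FE : @conductor d f = cspan w f.
  rewrite conductorE //; apply/seteqP; split=> [x [y e]|x [b [c ->]]].
    have /ZomegaP[b [c ey]] := valP y; exists b, c; apply: val_inj.
    by rewrite val_cpt -ey.
  have h : b%:~R + c%:~R * omega d \in Zadj_pred (omega d).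
    by apply/ZomegaP; exists b, c.
  by exists (exist (fun z => z \in Zadj_pred (omega d)) _ h); apply: val_cpt.
have JE : @Jfamily d f = slope_set w (f := f).
  by apply/funext => -[a|]; rewrite /= ?(slope_set_Some w_sqr w_span)
    ?(slope_set_None w_sqr w_span).
have na b c := @prime_norm_anisotropic d f t n b c d_sqf d_neq1 fD_prime w2.
rewrite FE JE; split; last exact: slope_set_inj.
move=> Q bQ; have QF := basic_primary_sub bQ.
have Q2 x y : Q (f%:R * cpt w f x y) by apply: (basic_primary_sqr w_sqr w_free na).
split=> [_ /(cspan2_cpt w_sqr)[x [y ->]] //|QnF].
have [[[idQ _] _] nQ] := bQ.
have [s e] := intermediate_ideal_slope f_prime w_free idQ Q2 QF nQ QnF.
by exists s.
Qed.
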